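(* Let $U\in\mathbb{C}^{M\times M}$ be unitary with orthonormal eigenvectors $|\psi_0\rangle,\dots,|\psi_{M-1}\rangle$ and eigenvalues $e^{\mathrm{i}\lambda_0},\dots,e^{\mathrm{i}\lambda_{M-1}}$, let $|\psi\rangle$ be a unit vector, and let $p_0=|\langle\psi|\psi_0\rangle|^2$. Assume that $p_0>1-\delta$, where $\delta<2\sqrt3-3$. Suppose that $1>\xi>\frac{3}{\pi}\arcsin\left((1-\delta)^{-1}\delta\right)$. Let $\eta\in(0,1)$ and $\epsilon\in(0,1)$ with $\epsilon\le\xi$, and let $$N_s=2\left\lceil\frac{4}{\beta(\delta,\xi)^2}\left(\log\frac4\eta+\log\left(\left\lceil\log_2\frac{\xi}{\epsilon}\right\rceil+1\right)\right)\right\rceil,\qquad \beta(\delta,\xi)=(1-\delta)\sin\frac{\pi\xi}{3}-\delta .$$ Run the algorithm described in the context with $J=\lceil\log_2(\xi/\epsilon)\rceil$ and this $N_s$. Then its output $\theta_J$ satisfies $$\mathbb{P}\left(|\theta_J-\lambda_0|_{2\pi}<\frac{\pi}{3}\epsilon\right)>1-\eta .$$ In addition, the maximal runtime and the total cost of the algorithm are, respectively, $$T_{\max}=\mathcal{O}\left(\xi\epsilon^{-1}\right),\qquad T_{\mathrm{total}}=\mathcal{O}\left(\frac{\xi\epsilon^{-1}}{\beta(\delta,\xi)^2}\left(\log(\eta^{-1})+\log\log(\epsilon^{-1})\right)\right)$$ (as $\epsilon\to0$, with implied constants independent of $\delta,\xi,\eta$).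
   Context: Angles are understood modulo $2\pi$, and $|\theta|_{2\pi}=\pi-|(\theta \bmod 2\pi)-\pi|$ is the distance from $\theta$ to $0$ modulo $2\pi$. $\arg$ denotes the principal argument (with an arbitrary value assigned to $\arg 0$). $\log$ is the natural logarithm. Hadamard test. For an integer $j\ge0$, one run of the ''real part'' circuit returns a random variable with values in $\{+1,-1\}$ and expectation $\mathrm{Re}\,\langle\psi|U^{2^j}|\psi\rangle$; one run of the ''imaginary part'' circuit returns a random variable with values in $\{+1,-1\}$ and expectation $\mathrm{Im}\,\langle\psi|U^{2^j}|\psi\rangle$. All runs are independent. Each such run has circuit depth (cost) $2^j$, i.e. the number of uses of (controlled) $U$. Algorithm (parameters $J$ and even $N_s$). Set $\theta_{-1}=0$. For $j=0,1,\dots,J$: (1) run the real part circuit for $U^{2^j}$ $N_s/2$ times and the imaginary part circuit $N_s/2$ times, and let $Z_j=X_j+\mathrm{i}Y_j$, where $X_j$ and $Y_j$ are the empirical averages of the real part and imaginary part outcomes, respectively; (2) let $S_j=\left\{\frac{2k\pi+\arg Z_j}{2^j}: k=0,\dots,2^j-1\right\}$; (3) let $\theta_j=\arg\min_{\theta\in S_j}|\theta-\theta_{j-1}|_{2\pi}$ (ties broken arbitrarily). Output $\theta_J$. $T_{\max}$ is the maximal depth of any circuit run in the algorithm, and $T_{\mathrm{total}}$ is the sum of the circuit depths over all runs. *)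

(* Defs.v *)
From HB Require Import structures.
From mathcomp Require Import all_boot all_order all_algebra.
From mathcomp Require Import complex.
From mathcomp Require Import all_classical all_reals all_analysis.

Set Implicit Arguments.
Unset Strict Implicit.
Unset Printing Implicit Defensive.

Import Order.TTheory GRing.Theory Num.Theory.
Import numFieldNormedType.Exports.

Local Open Scope classical_set_scope.
Local Open Scope complex_scope.
Local Open Scope sesquilinear_scope.
Local Open Scope ring_scope.

Section Angles.
Variable R : realType.
Implicit Types (t a : R) (z : R[i]).

Definition mod2pi t : R := t - 2 * pi * (Num.floor (t / (2 * pi)))%:~R.

Definition dist2pi t : R := pi - `|mod2pi t - pi|.

Definition expi t : R[i] := cos t +i* sin t.

(* [normc] is the modulus as an element of [R]; [`|z|] would live in [R[i]]. *)
Definition modulus z : R := ComplexField.Normc.normc z.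

(* The principal argument, in ]-pi, pi]; since the set is empty for z = 0,
   [a0] is the value assigned to arg 0. *)
Definition parg (a0 : R) z : R :=
  xget a0 [set a | [/\ z != 0, - pi < a, a <= pi
                     & z = (modulus z)%:C * expi a]].

Definition log2 (x : R) : R := ln x / ln 2.

End Angles.

Section LinearAlgebra.
Variables (R : realType) (m : nat).
Implicit Types (u v : 'cV[R[i]]_m.+1) (U : 'M[R[i]]_m.+1).

(* The bracket <u|v>, conjugate-linear in [u]. *)
Definition braket u v : R[i] := (u^t* *m v) ord0 ord0.

Definition orthonormal_eigenvectors U (psi : 'I_m.+1 -> 'cV[R[i]]_m.+1)
    (lambda : 'I_m.+1 -> R) : Prop :=
  (forall k l, braket (psi k) (psi l) = (k == l)%:R) /\
  (forall k, U *m psi k = expi (lambda k) *: psi k).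

End LinearAlgebra.

Section LevelsAndShots.
Variable R : realType.
Implicit Types delta xi eta eps : R.

Definition beta delta xi : R := (1 - delta) * sin (pi * xi / 3) - delta.

(* The ceilings below are nonnegative integers in the range of parameters of
   interest, so that the absolute value is a mere cast to [nat]. *)
Definition num_levels xi eps : nat := `|Num.ceil (log2 (xi / eps))|%N.

Definition num_shots delta xi eta eps : nat :=
  (2 * `|Num.ceil (4 / beta delta xi ^+ 2 *
           (ln (4 / eta) + ln ((num_levels xi eps)%:R + 1)))|)%N.

End LevelsAndShots.

Section Runs.
Variables J Ns : nat.

(* A run [(j, b, i)] is the i-th execution of the circuit for U^(2^j), in its
   real part version if [b = true] and its imaginary part version otherwise. *)
Definition run : finType := ('I_J.+1 * bool * 'I_Ns./2)%type.

Definition depth (r : run) : nat := (2 ^ r.1.1)%N.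

Definition T_max : nat := \max_(r : run) depth r.

Definition T_total : nat := \sum_(r : run) depth r.

End Runs.

Section Algorithm.
Variables (R : realType) (d : measure_display) (T : measurableType d).
Variable P : probability T R.

Definition mutually_independent (I : finType) (X : I -> {RV P >-> R}) : Prop :=
  forall (S : {set I}) (A : I -> set R), (forall i, measurable (A i)) ->
    P (\bigcap_(i in [set` S]) (X i @^-1` A i)) =
    (\prod_(i in S) P (X i @^-1` A i))%E.

Definition hadamard_outcomes (m : nat) (U : 'M[R[i]]_m.+1)
    (psi : 'cV[R[i]]_m.+1) (J Ns : nat) (X : run J Ns -> {RV P >-> R}) : Prop :=
  [/\ forall r w, X r w = 1 \/ X r w = -1,
      forall (j : 'I_J.+1) (i : 'I_Ns./2), ('E_P[X (j, true, i)] =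
        (complex.Re (braket psi (U ^+ (2 ^ j) *m psi)))%:E)%E,
      forall (j : 'I_J.+1) (i : 'I_Ns./2), ('E_P[X (j, false, i)] =
        (complex.Im (braket psi (U ^+ (2 ^ j) *m psi)))%:E)%E
    & mutually_independent X].

Definition empirical_average (J Ns : nat) (X : run J Ns -> T -> R)
    (j : 'I_J.+1) (w : T) : R[i] :=
  ((\sum_(i < Ns./2) X (j, true, i) w) / (Ns./2)%:R) +i*
  ((\sum_(i < Ns./2) X (j, false, i) w) / (Ns./2)%:R).

Definition candidates (a0 : R) (j : nat) (z : R[i]) : set R :=
  [set t | exists2 k : nat, (k < 2 ^ j)%N
         & t = (2 * k%:R * pi + parg a0 z) / 2 ^+ j].

(* [t] realises the minimum of [f] over [S]; several [t] may do so. *)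
Definition is_argmin (f : R -> R) (S : set R) (t : R) : Prop :=
  S t /\ forall s, S s -> f t <= f s.

Definition previous (theta : nat -> T -> R) (j : nat) (w : T) : R :=
  if j is i.+1 then theta i w else 0.

(* The angles [theta j], j <= J, are produced by some execution of the
   algorithm: ties may be broken in any (measurable) way, possibly depending on
   the past or on extra randomness.  Values [theta j] for j > J are junk. *)
Definition algorithm_angles (a0 : R) (J Ns : nat) (X : run J Ns -> T -> R)
    (theta : nat -> T -> R) : Prop :=
  forall (w : T) (j : 'I_J.+1),
    is_argmin (fun t => dist2pi (t - previous theta j w))
              (candidates a0 j (empirical_average X j w))
              (theta j w).

End Algorithm.

(* Main.v *)
(** Expanding psi in the eigenbasis, <psi|U^n|psi> lies within [1 - p0] of
    [p0 e^{i n lambda0}]. If the empirical average [Z_j] lies within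
    [b = p0 sin (pi xi / 3) - (1 - p0)] of its expectation, it is therefore at
    distance less than [p0 sin (pi xi / 3)] from [p0 e^{i 2^j lambda0}], and
    [arg Z_j] is within [pi xi / 3 < pi / 3] of [2^j lambda0]. Inductively
    [theta_j] is then within [(pi xi / 3) / 2^j] of [lambda0]: one candidate is
    that close, and the others, shifted by multiples of [2 pi / 2^j], are
    farther from [theta_{j-1}]. Hoeffding's inequality and a union bound over
    the [2 (J + 1)] averages control the failure probability; since
    [p0 > 1 - delta] gives [b > beta], the resulting bound is strict. *)

Require Import Defs.
From HB Require Import structures.
From mathcomp Require Import all_boot all_order all_algebra.
From mathcomp Require Import complex ring lra measurable_realfun.
From mathcomp Require Import all_classical all_reals all_analysis.

Set Implicit Arguments.
Unset Strict Implicit.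
Unset Printing Implicit Defensive.

Import Order.TTheory GRing.Theory Num.Theory.
Import numFieldNormedType.Exports.

Local Open Scope classical_set_scope.
Local Open Scope complex_scope.
Local Open Scope ring_scope.

(** * Angles modulo 2 pi and the deterministic part of the algorithm *)

Section AngleLemmas.
Variable R : realType.
Implicit Types (s t a b c : R) (z : R[i]).

Lemma mod2pi_bounds t : 0 <= mod2pi t < 2 * pi.
Proof.
have p0 := pi_gt0 R.
have p2 : 0 < 2 * pi :> R by lra.
rewrite /mod2pi; set f := Num.floor _.
have /andP[h1 h2] : f%:~R <= t / (2 * pi) < (f + 1)%:~R
  by rewrite Num.Theory.floor_le_tmp /= Num.Theory.floorD1_gt.
move: h1 h2; rewrite ler_pdivlMr// ltr_pdivrMr// intrD; nra.
Qed.

(** With [dist2pi_attained], this makes [dist2pi t] the least distance from [t] to a multiple of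
    [2 * pi]; the triangle inequality and symmetry follow from that description. *)
Lemma dist2pi_le_norm t (k : int) : dist2pi t <= `|t - 2 * pi * k%:~R|.
Proof.
have p0 := pi_gt0 R.
have /andP[m0 m2] := mod2pi_bounds t.
rewrite /dist2pi; move: m0 m2; set mm := mod2pi t => m0 m2.
have -> : t - 2 * pi * k%:~R =
    mm + 2 * pi * (Num.floor (t / (2 * pi)) - k)%:~R.
  by rewrite /mm /mod2pi intrB; ring.
set n := (_ - k).
have h1 : - `|mm - pi| <= mm - pi by rewrite lerNl -normrN ler_norm.
have h2 := ler_norm (mm - pi).
case: (lerP 0 n) => hn.
  have n0 : 0 <= n%:~R :> R by rewrite ler0z.
  have := mulr_ge0 (ltW p0) n0; move=> h3.
  by apply: le_trans (ler_norm _); lra.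
have n1 : n%:~R <= -1 :> R.
  by rewrite (_ : -1 = (-1)%:~R)// ler_int -ltzD1 addNr.
have : pi * n%:~R <= - pi :> R by rewrite -[leRHS]mulrN1 ler_pM2l.
move=> h3.
by have := ler_norm (- (mm + 2 * pi * n%:~R)); rewrite normrN; lra.
Qed.

Lemma dist2pi_attained t : exists k : int, dist2pi t = `|t - 2 * pi * k%:~R|.
Proof.
have p0 := pi_gt0 R.
have /andP[m0 m2] := mod2pi_bounds t.
case: (lerP (mod2pi t) pi) => h.
  exists (Num.floor (t / (2 * pi))).
  rewrite -/(mod2pi t) /dist2pi (ger0_norm m0) ler0_norm; lra.
exists (Num.floor (t / (2 * pi)) + 1).
have -> : t - 2 * pi * (Num.floor (t / (2 * pi)) + 1)%:~R =
    mod2pi t - 2 * pi by rewrite /mod2pi intrD; ring.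
rewrite /dist2pi gtr0_norm ?subr_gt0// ler0_norm; lra.
Qed.

Lemma dist2pi_ltP t c :
  dist2pi t < c <-> exists k : int, `|t - 2 * pi * k%:~R| < c.
Proof.
split=> [h|[k]]; last exact: le_lt_trans (dist2pi_le_norm t k).
by have [k kE] := dist2pi_attained t; exists k; rewrite -kE.
Qed.

Lemma dist2pi_le_pi t : dist2pi t <= pi.
Proof. by rewrite /dist2pi gerBl. Qed.

Lemma dist2pi_triangle s t : dist2pi (s + t) <= dist2pi s + dist2pi t.
Proof.
have [k ->] := dist2pi_attained s; have [l ->] := dist2pi_attained t.
apply: le_trans (dist2pi_le_norm _ (k + l)) _.
rewrite intrD; apply: le_trans (ler_normD _ _).
by rewrite le_eqVlt; apply/orP; left; apply/eqP; congr `|_|; ring.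
Qed.

Lemma dist2piN t : dist2pi (- t) = dist2pi t.
Proof.
have le s : dist2pi (- s) <= dist2pi s.
  have [k ->] := dist2pi_attained s.
  apply: le_trans (dist2pi_le_norm _ (- k)) _.
  by rewrite -normrN intrN mulrN !opprD !opprK.
by apply/eqP; rewrite eq_le le -{1}(opprK t) le.
Qed.

Lemma cosDperiod t (k : int) : cos (t + 2 * pi * k%:~R) = cos t.
Proof.
have H (n : nat) s : cos (s + 2 * pi * n%:R) = cos s.
  rewrite -(periodicn (@cosD2pi R) n s); congr cos.
  by rewrite -mulrnA -[pi *+ _]mulr_natr natrM; ring.
case: k => n; first exact: H.
by rewrite NegzE intrN mulrN -[LHS](H n.+1) subrK.
Qed.

Lemma cos_dist2pi t : cos (dist2pi t) = cos t.
Proof.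
have [k ->] := dist2pi_attained t.
by rewrite cos_norm -mulrN -intrN cosDperiod.
Qed.

Lemma dist2pi_ge0 t : 0 <= dist2pi t.
Proof. by have [k ->] := dist2pi_attained t. Qed.

(** * Polar form and the principal argument *)

Lemma modulusE (x y : R) : modulus (x +i* y) = Num.sqrt (x ^+ 2 + y ^+ 2).
Proof. by []. Qed.

Lemma sqr_modulus z : modulus z ^+ 2 = complex.Re z ^+ 2 + complex.Im z ^+ 2.
Proof. by case: z => x y; rewrite modulusE sqr_sqrtr ?addr_ge0 ?sqr_ge0. Qed.

Lemma modulus_ge0 z : 0 <= modulus z.
Proof. by case: z => x y; apply: sqrtr_ge0. Qed.

Lemma modulus_gt0 z : z != 0 -> 0 < modulus z.
Proof.
move=> z0; rewrite lt_def modulus_ge0 andbT.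
by apply: contra_neq z0 => /ComplexField.Normc.eq0_normc.
Qed.

Lemma polar_decomposition z : z != 0 ->
  exists a, [/\ - pi < a, a <= pi & z = (modulus z)%:C * expi a].
Proof.
move=> z0; have r0 := modulus_gt0 z0; have := sqr_modulus z.
move: r0; case: z z0 => x y z0; set r := modulus _ => r0 /= rE.
have rn0 : r != 0 by rewrite gt_eqF.
pose c := x / r; pose s := y / r.
have xE : x = r * c by rewrite /c mulrCA divff// mulr1.
have yE : y = r * s by rewrite /s mulrCA divff// mulr1.
have cs : c ^+ 2 + s ^+ 2 = 1.
  apply: (@mulfI _ (r ^+ 2)); first by rewrite expf_neq0.
  by rewrite mulr1 [RHS]rE xE yE; ring.
have c1 : -1 <= c <= 1 by nra.
have p0 := pi_gt0 R.
have cE : cos (acos c) = c by rewrite acosK// in_itv.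
have sE : sin (acos c) = `|s|.
  by rewrite sin_acos// -cs addrAC subrr add0r sqrtr_sqr.
suff [a [h1 h2 h3 h4]] : exists a, [/\ - pi < a, a <= pi, cos a = c & sin a = s].
  exists a; split=> //; rewrite /expi h3 h4 xE yE.
  by apply/eqP; rewrite eq_complex /= -xE -yE; apply/andP; split; apply/eqP; ring.
case: (lerP 0 s) => s0.
  exists (acos c); rewrite cE sE ger0_norm//; split=> //.
    by have := acos_ge0 c1; lra.
  exact: acos_lepi.
exists (- acos c); rewrite cosN sinN cE sE ltr0_norm// opprK; split=> //.
  (* The angle [-pi] is excluded: [c = -1] would force [s = 0], while here [s < 0]. *)
  rewrite ltrN2; apply: acos_ltpi; move: c1 => /andP[c1 ->].
  by rewrite andbT lt_neqAle c1 andbT; apply/eqP => ce; rewrite -ce in cs; nra.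
by have := acos_ge0 c1; lra.
Qed.

(** For nonzero [z] the set in [parg] is inhabited, so the default [a0] is not returned. *)
Lemma parg_polar a0 z : z != 0 -> z = (modulus z)%:C * expi (parg a0 z).
Proof.
move=> z0; have [a [h1 h2 h3]] := polar_decomposition z0.
rewrite /parg; case: xgetP => [b _ [//]|/(_ a)].
by case.
Qed.

(** The disc of radius [p sin alpha] about [p e^{i phi}] fits in the cone of half-angle [alpha]. By
    the law of cosines, [r^2 + p^2 cos^2 alpha < 2 r p cos (a - phi)], and the left side is at least
    [2 r p cos alpha]. *)
Lemma parg_near a0 z (p phi alpha : R) : 0 < p -> 0 < alpha < pi / 2 ->
  modulus (z - p%:C * expi phi) < p * sin alpha ->
  dist2pi (parg a0 z - phi) < alpha.
Proof.
move=> p0 /andP[al0 al1] close.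
have pi0 := pi_gt0 R.
have ca : 0 < cos alpha by apply: cos_gt0_pihalf; lra.
have csa := cos2Dsin2 alpha; have csp := cos2Dsin2 phi.
have sq : modulus (z - p%:C * expi phi) ^+ 2 < p ^+ 2 * (1 - cos alpha ^+ 2).
  rewrite -sin2cos2 -exprMn ltr_pXn2r// nnegrE ?(le_trans _ (ltW close))//;
    exact: modulus_ge0.
have z0 : z != 0.
  apply/eqP => z0; move: sq; rewrite z0 sqr_modulus /expi /=; nra.
move: sq; rewrite {1}(parg_polar a0 z0) sqr_modulus /expi /=.
have := modulus_gt0 z0; set r := modulus z; set a := parg a0 z => r0.
have csa' := cos2Dsin2 a.
have -> : (r * cos a - 0 * sin a - (p * cos phi - 0 * sin phi)) ^+ 2 +
   (r * sin a + 0 * cos a - (p * sin phi + 0 * cos phi)) ^+ 2 =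
   r ^+ 2 + p ^+ 2 - 2 * r * p * cos (a - phi).
  transitivity (r ^+ 2 * (cos a ^+ 2 + sin a ^+ 2) +
    p ^+ 2 * (cos phi ^+ 2 + sin phi ^+ 2) - 2 * r * p * cos (a - phi)).
    by rewrite cosB; ring.
  by rewrite csa' csp !mulr1.
move=> lt; have rp : 0 < 2 * r * p by rewrite !mulr_gt0.
have : cos alpha < cos (a - phi).
  rewrite -(ltr_pM2l rp); have := sqr_ge0 (r - p * cos alpha); nra.
(* Cosine is decreasing on [[0, pi]], where [dist2pi] takes its values. *)
rewrite -(cos_dist2pi (a - phi)) ltr_cos// in_itv /=; last by apply/andP; lra.
by rewrite dist2pi_ge0 dist2pi_le_pi.
Qed.

(* Two candidates differ by a multiple of [2 pi / 2 ^ j]; the argmin and the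
   candidate close to [lambda] are less than [6 c / 2 ^ j] apart. *)
Lemma argmin_candidate_near a0 (j : nat) z (prev lambda c t : R) :
  c <= pi / 3 -> dist2pi (parg a0 z - 2 ^+ j * lambda) < c ->
  (0 < j)%N -> dist2pi (prev - lambda) < 2 * c / 2 ^+ j ->
  is_argmin (fun t => dist2pi (t - prev)) (candidates a0 j z) t ->
  dist2pi (t - lambda) < c / 2 ^+ j.
Proof.
move=> cpi /dist2pi_ltP[l la] j0 prevP [tS tmin].
have pi0 := pi_gt0 R.
have E0 : 0 < 2 ^+ j :> R by rewrite exprn_gt0.
have En0 : 2 ^+ j != 0 :> R by rewrite gt_eqF.
have Z0 : 0 < (2 ^ j)%:Z by rewrite ltz_nat expn_gt0.
set e := parg a0 z - 2 ^+ j * lambda - 2 * pi * l%:~R in la.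
have aE : parg a0 z = 2 ^+ j * lambda + 2 * pi * l%:~R + e by rewrite /e; ring.
(* The index [-l] would give a candidate at [lambda + e / 2 ^ j]; reducing it modulo [2 ^ j] puts it
   in range and costs [q] full turns. *)
pose q := (- l %/ (2 ^ j)%:Z)%Z; pose k := `|(- l %% (2 ^ j)%:Z)%Z|%N.
have kE : k%:Z = (- l %% (2 ^ j)%:Z)%Z by rewrite gez0_abs// modz_ge0// gt_eqF.
have k_lt : (k < 2 ^ j)%N by rewrite -ltz_nat kE ltz_pmod.
have kE' : k%:R = - l%:~R - q%:~R * 2 ^+ j :> R.
  have := congr1 (fun x : int => x%:~R : R) (divz_eq (- l) (2 ^ j)%:Z).
  by rewrite -/q -kE intrN intrD intrM -!pmulrn natrX; lra.
pose s := (2 * k%:R * pi + parg a0 z) / 2 ^+ j.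
have sS : candidates a0 j z s by exists k.
have sE : s = lambda + e / 2 ^+ j - 2 * pi * q%:~R.
  by rewrite /s kE' aE; field.
have s_lt : dist2pi (s - lambda) < c / 2 ^+ j.
  apply/dist2pi_ltP; exists (- q).
  rewrite (_ : _ - _ = e / 2 ^+ j); last by rewrite sE intrN; ring.
  by rewrite normrM normfV (gtr0_norm E0) ltr_pM2r ?invr_gt0.
(* By minimality [t] and [s] are at most twice [dist2pi (s - prev)] apart, and that distance is
   below [(c + 2 c) / 2 ^ j]; this is where [c <= pi / 3] enters. *)
have ts : dist2pi (t - s) < 2 * pi / 2 ^+ j.
  have h1 : dist2pi (t - s) <= dist2pi (t - prev) + dist2pi (s - prev).
    by rewrite -(dist2piN (s - prev)) (le_trans _ (dist2pi_triangle _ _))//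
      opprB addrA subrK.
  have h2 : dist2pi (s - prev) <= dist2pi (s - lambda) + dist2pi (prev - lambda).
    by rewrite -(dist2piN (prev - _)) (le_trans _ (dist2pi_triangle _ _))//
      opprB addrA subrK.
  have h3 : dist2pi (t - prev) <= dist2pi (s - prev) := tmin s sS.
  have h4 : 6 * c / 2 ^+ j <= 2 * pi / 2 ^+ j.
    by rewrite ler_pM2r ?invr_gt0//; lra.
  apply: le_lt_trans h1 _; apply: lt_le_trans h4.
  rewrite (_ : 6 * c / 2 ^+ j = 2 * (c / 2 ^+ j + 2 * c / 2 ^+ j)); last by field.
  lra.
have [k' k'_lt tE] := tS.
have [n nE] := dist2pi_attained (t - s).
have tsn : t - s = 2 * pi * n%:~R.
  (* Modulo [2 * pi], candidates lie on a grid of step [2 pi / 2 ^ j], so being less than one step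
     apart forces equality. *)
  have : `|((k'%:Z - k%:Z - n * (2 ^ j)%:Z) : int)%:~R| < 1 :> R.
    move: ts; rewrite nE.
    rewrite (_ : t - s - _ =
        2 * pi / 2 ^+ j * (k'%:Z - k%:Z - n * (2 ^ j)%:Z)%:~R); last first.
      by rewrite tE /s !intrB intrM -!pmulrn natrX; field.
    rewrite normrM gtr0_norm; last by rewrite !mulr_gt0 ?invr_gt0.
    by rewrite -[ltRHS]mulr1 ltr_pM2l// !mulr_gt0 ?invr_gt0.
  rewrite -intr_norm ltrz1 => h.
  have {}h : k'%:Z - k%:Z - n * (2 ^ j)%:Z = 0.
    by apply/eqP; rewrite -normr_le0 -ltzD1 add0r.
  have : k'%:R = k%:R + n%:~R * 2 ^+ j :> R.
    have := congr1 (fun x : int => x%:~R : R) h.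
    by rewrite /= !intrB intrM -!pmulrn natrX; lra.
  by rewrite tE /s => ->; field.
apply: le_lt_trans s_lt.
have [m ->] := dist2pi_attained (s - lambda).
apply: le_trans (dist2pi_le_norm _ (n + m)) _.
rewrite (_ : t = s + 2 * pi * n%:~R); last by rewrite -tsn; ring.
by rewrite le_eqVlt; apply/orP; left; apply/eqP; rewrite intrD; congr `|_|; ring.
Qed.

Lemma angles_near a0 (J : nat) (z : nat -> R[i]) (theta : nat -> R) lambda c :
  c <= pi / 3 ->
  (forall j, (j <= J)%N -> dist2pi (parg a0 (z j) - 2 ^+ j * lambda) < c) ->
  (forall j, (j <= J)%N ->
    is_argmin (fun t => dist2pi (t - if j is i.+1 then theta i else 0))
      (candidates a0 j (z j)) (theta j)) ->
  forall j, (j <= J)%N -> dist2pi (theta j - lambda) < c / 2 ^+ j.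
Proof.
move=> cpi zP thetaP; elim=> [_|j IH jJ].
  (* Level 0 has the single candidate [k = 0], so no earlier angle is involved. *)
  have [[k]] := thetaP 0%N isT; rewrite expn0 ltnS leqn0 => /eqP -> thE _.
  have := zP 0%N isT; rewrite thE !expr0 mul1r !divr1.
  by rewrite mulr0 mul0r add0r.
apply: argmin_candidate_near (thetaP _ jJ) => //; first exact: zP.
suff -> : 2 * c / 2 ^+ j.+1 = c / 2 ^+ j by apply: IH; exact: ltnW.
by rewrite exprS; field; rewrite expf_neq0.
Qed.

End AngleLemmas.

(** * Spectral expansion of the Hadamard test expectations *)

Section Spectral.
Variable R : realType.
Local Open Scope sesquilinear_scope.

Lemma norm_modulus (z : R[i]) : `|z| = (modulus z)%:C.
Proof. by []. Qed.

Lemma expiD (s t : R) : expi (s + t) = expi s * expi t.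
Proof.
by apply/eqP; rewrite eq_complex /= cosD sinD eqxx addrC eqxx.
Qed.

Lemma expiMn (t : R) n : expi (n%:R * t) = expi t ^+ n.
Proof.
elim: n => [|n IH]; first by rewrite mul0r /expi cos0 sin0.
by rewrite exprS -IH -expiD -natr1 mulrDl mul1r addrC.
Qed.

Lemma modulus_expi (t : R) : modulus (expi t) = 1.
Proof. by rewrite /modulus /= cos2Dsin2 sqrtr1. Qed.

Lemma modulus_sum (I : finType) (Q : pred I) (F : I -> R[i]) :
  modulus (\sum_(i | Q i) F i) <= \sum_(i | Q i) modulus (F i).
Proof.
elim/big_rec2: _ => [|i x y _ h]; first by rewrite /modulus ComplexField.Normc.normc0.
by apply: le_trans (le_normcD _ _) _; rewrite lerD2l.
Qed.

Variable m : nat.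
Variables (U : 'M[R[i]]_m.+1) (psis : 'I_m.+1 -> 'cV[R[i]]_m.+1).
Variables (lambda : 'I_m.+1 -> R) (psi : 'cV[R[i]]_m.+1).
Hypothesis psisP : orthonormal_eigenvectors U psis lambda.
Let p k : R := modulus (braket psi (psis k)) ^+ 2.

Lemma expmx_eigenvector n k :
  U ^+ n *m psis k = expi (n%:R * lambda k) *: psis k.
Proof.
rewrite expiMn; elim: n => [|n IH]; first by rewrite !expr0 mul1mx scale1r.
by rewrite exprSr -mulmxA psisP.2 -scalemxAr IH scalerA -exprS.
Qed.

(** Orthonormality says that the square matrix [W] of eigenvectors has left inverse [W^t*], which is
    then also a right inverse; applying [W *m W^t*] to [psi] gives the expansion. *)
Lemma eigenbasis_expansion :
  psi = \sum_k (braket psi (psis k))^* *: psis k.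
Proof.
pose W := \matrix_(i, j) psis j i ord0.
have WW : W *m W^t* = 1%:M.
  apply: mulmx1C; apply/matrixP => k l; rewrite !mxE -psisP.1 /braket mxE.
  by apply: eq_bigr => i _; rewrite !mxE.
rewrite -{1}[psi]mul1mx -WW -mulmxA; apply/matrixP => i j.
rewrite ord1 mxE summxE; apply: eq_bigr => k _; rewrite !mxE mulrC; congr (_ * _).
rewrite /braket mxE rmorph_sum; apply: eq_bigr => l _; rewrite !mxE rmorphM /=.
by rewrite mulrC; congr (_ * _); exact: esym (conjCK _).
Qed.

Lemma braket_expmx n : braket psi (U ^+ n *m psi) =
  \sum_k (p k)%:C * expi (n%:R * lambda k).
Proof.
(* Only the ket is expanded: the bra then supplies the conjugate factor that turns each coefficient
   into [p k]. *)
rewrite {2}eigenbasis_expansion mulmx_sumr /braket mulmx_sumr summxE.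
apply: eq_bigr => k _.
rewrite -scalemxAr expmx_eigenvector scalerA -scalemxAr mxE -/(braket _ _).
rewrite mulrAC -/(braket _ _); congr (_ * _).
by rewrite rmorphXn /= -norm_modulus normCK mulrC.
Qed.

Hypothesis psi1 : braket psi psi = 1.

(** The case [n = 0] of [braket_expmx], where all phases are 1. *)
Lemma sum_overlaps : \sum_k p k = 1.
Proof.
have := braket_expmx 0; rewrite expr0 mul1mx psi1 => /eqP.
under eq_bigr do rewrite mul0r (_ : expi 0 = 1) ?mulr1 /expi ?cos0 ?sin0//.
by rewrite -rmorph_sum /= eq_complex /= => /andP[/eqP <-].
Qed.

Lemma braket_expmx_near n :
  modulus (braket psi (U ^+ n *m psi) - (p ord0)%:C * expi (n%:R * lambda ord0))
  <= 1 - p ord0.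
Proof.
rewrite braket_expmx -sum_overlaps !(bigD1 ord0 (P := xpredT))//= addrAC subrr add0r.
rewrite [leRHS]addrAC subrr add0r; apply: le_trans (modulus_sum _ _) _.
apply: ler_sum => k _; rewrite /modulus ComplexField.Normc.normcM -!/(modulus _).
rewrite modulus_expi mulr1 /modulus /= expr0n addr0 sqrtr_sqr.
by rewrite ger0_norm ?sqr_ge0.
Qed.

End Spectral.

(** * Hoeffding's inequality for signs *)

Section Hoeffding.
Variable R : realType.

Lemma ge0_derive_le0 (f f' : R -> R) (x : R) :
  (forall y : R, is_derive y 1 f (f' y)) -> (forall y, 0 <= y -> 0 <= f' y) ->
  0 <= x -> f 0 <= f x.
Proof.
move=> fP f'0 x0.
apply: (@ger0_derive1_le_cc _ f 0 x) => //; last 2 first.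
- by rewrite in_itv /= lexx.
- by rewrite in_itv /= x0 lexx.
- move=> y; rewrite in_itv /= => /andP[/ltW y0 _].
  by rewrite derive1E derive_val f'0.
- by apply: derivable_within_continuous => y _; apply: ex_derive.
Qed.

(* The logarithm of the left-hand side has derivative [(A - B) / (A + B)] with
   [A = p e^l], [B = q e^-l]; that quotient grows with slope at most 1 from
   [p - q]. *)
Lemma rademacher_mgf_ge0 (p q l : R) : 0 <= p -> 0 <= q -> p + q = 1 -> 0 <= l ->
  p * expR l + q * expR (- l) <= expR (l * (p - q) + l ^+ 2 / 2).
Proof.
move=> p0 q0 pq l0.
pose A x : R := p * expR x; pose B x : R := q * expR (- x).
have S0 x : 0 < A x + B x.
  have := expR_gt0 x; have := expR_gt0 (- x) => h1 h2; rewrite /A /B.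
  have [p00|pn] := eqVneq p 0; first by rewrite p00 mul0r add0r mulr_gt0//; lra.
  by rewrite ltr_wpDr ?mulr_ge0 ?mulr_gt0 ?expR_ge0// lt_def pn.
have dA (x : R) : is_derive x 1 A (A x).
  by apply: is_derive_eq; rewrite /A /GRing.scale /=; ring.
have dB (x : R) : is_derive x 1 B (- B x).
  by apply: is_derive_eq; rewrite /B /GRing.scale /=; ring.
(* [A - B] and [A + B] are each other's derivative, so their quotient has derivative 1 minus its
   square, and [h] has the square itself. Below, [h] is the derivative of [g]. *)
pose h x := (p - q) + x - (A x - B x) / (A x + B x).
have dh (x : R) : is_derive x 1 h (((A x - B x) / (A x + B x)) ^+ 2).
  have dV : is_derive x 1 (fun x => (A x + B x)^-1)
      (- (A x + B x) ^- 2 *: (A x - B x)).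
    by apply: is_deriveV; rewrite gt_eqF.
  apply: is_derive_eq; rewrite /GRing.scale /=.
  by have := S0 x => /lt0r_neq0 ?; field.
have h0 (x : R) : 0 <= x -> 0 <= h x.
  move=> x0; apply: le_trans (ge0_derive_le0 dh _ x0) => [|y _]; last exact: sqr_ge0.
  by rewrite /h /A /B oppr0 expR0 !mulr1 pq divr1; lra.
pose g x := x * (p - q) + x ^+ 2 / 2 - ln (A x + B x).
have dg (x : R) : is_derive x 1 g (h x).
  have dl : is_derive x 1 (fun x => ln (A x + B x)) ((A x + B x)^-1 * (A x - B x)).
    apply: (@is_derive1_comp _ (@ln R) (fun x => A x + B x)).
    by apply: is_derive1_ln; exact: S0.
  rewrite /g; apply: is_derive_eq; rewrite /GRing.scale /= /h.
  by have := S0 x => /lt0r_neq0 ?; field.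
have : 0 <= g l.
  apply: le_trans (ge0_derive_le0 dg h0 l0).
  by rewrite /g /A /B oppr0 expR0 !mulr1 pq ln1 expr0n /=; lra.
rewrite /g subr_ge0 => le.
by rewrite -[leLHS]lnK ?posrE ?S0// ler_expR.
Qed.

Lemma rademacher_mgf (p q l : R) : 0 <= p -> 0 <= q -> p + q = 1 ->
  p * expR l + q * expR (- l) <= expR (l * (p - q) + l ^+ 2 / 2).
Proof.
move=> p0 q0 pq; case: (lerP 0 l) => [|/ltW l0]; first exact: rademacher_mgf_ge0.
have qp : q + p = 1 by rewrite addrC.
have := rademacher_mgf_ge0 q0 p0 qp (l := - l).
rewrite oppr_ge0 opprK sqrrN [X in _ -> X <= _]addrC => /(_ l0).
by rewrite mulNr -mulrN opprB.
Qed.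

Definition pm1 (b : bool) : R := if b then 1 else -1.

Variables (I : finType) (p : I -> bool -> R) (mu : R).
Hypothesis p_ge0 : forall i b, 0 <= p i b.
Hypothesis p_sum1 : forall i, p i true + p i false = 1.
Hypothesis p_mean : forall i, p i true - p i false = mu.

(* [e] is a sign selecting the upper or the lower tail. *)
Lemma hoeffding_one_sided (e t : R) : e ^+ 2 = 1 -> 0 <= t ->
  \sum_(s : {ffun I -> bool} |
        #|I|%:R * t <= e * \sum_i (pm1 (s i) - mu)) \prod_i p i (s i)
  <= expR (- (#|I|%:R * t ^+ 2 / 2)).
Proof.
move=> e1 t0.
(* Chernoff weights with the optimal parameter [t]: on the tail event their product is at least that
   of the [p i], and [rademacher_mgf] at [t * e] bounds each factor's total by
   [expR (- (t ^+ 2 / 2))]. *)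
pose F i b := p i b * expR (t * (e * (pm1 b - mu) - t)).
have F0 i b : 0 <= F i b by rewrite mulr_ge0// expR_ge0.
apply: (@le_trans _ _ (\sum_(s : {ffun I -> bool}) \prod_i F i (s i))).
  apply: le_trans (_ : _ <= \sum_(s : {ffun I -> bool} |
    #|I|%:R * t <= e * \sum_i (pm1 (s i) - mu)) \prod_i F i (s i)) _.
    apply: ler_sum => s hs; rewrite /F big_split /= ler_peMr ?prodr_ge0//.
    rewrite -expR_sum -expR0 ler_expR -mulr_sumr mulr_ge0//.
    by rewrite sumrB -mulr_sumr sumr_const -mulr_natl subr_ge0.
  rewrite [leRHS](bigID (fun s : {ffun I -> bool} =>
    #|I|%:R * t <= e * \sum_i (pm1 (s i) - mu)))/= lerDl.
  by apply: sumr_ge0 => s _; apply: prodr_ge0.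
(* The sum over sign vectors factors into a product over [i]. *)
rewrite -(bigA_distr_bigA F) /=.
apply: (@le_trans _ _ (\prod_(i : I) expR (- (t ^+ 2 / 2)))).
  apply: ler_prod => i _; rewrite sumr_ge0//= big_bool /F /pm1.
  have := @rademacher_mgf (p i true) (p i false) (t * e) (p_ge0 _ _) (p_ge0 _ _)
    (p_sum1 _).
  rewrite p_mean exprMn e1 mulr1 => mgf.
  rewrite (_ : t * (e * (1 - mu) - t) = t * e - (t * e * mu + t ^+ 2));
    last by ring.
  rewrite (_ : t * (e * (-1 - mu) - t) = - (t * e) - (t * e * mu + t ^+ 2));
    last by ring.
  rewrite !(expRD _ (- (_ + _))) !mulrA /= -mulrDl.
  apply: le_trans (ler_wpM2r (expR_ge0 _) mgf) _.
  by rewrite -expRD ler_expR; lra.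
by rewrite prodr_const -expRM_natl mulrN mulrA.
Qed.

(** The product weights are the law of independent signs, so this is a tail probability written as a
    finite sum. The factor 2 counts the tails [e = 1] and [e = -1]. *)
Lemma hoeffding_two_sided (t : R) : 0 <= t ->
  \sum_(s : {ffun I -> bool} |
        #|I|%:R * t <= `|\sum_i (pm1 (s i) - mu)|) \prod_i p i (s i)
  <= 2 * expR (- (#|I|%:R * t ^+ 2 / 2)).
Proof.
move=> t0.
rewrite [leRHS]mulr_natl mulr2n.
have eN : (-1) ^+ 2 = 1 :> R by rewrite sqrrN expr1n.
have := lerD (hoeffding_one_sided (expr1n _ 2) t0) (hoeffding_one_sided eN t0).
apply: le_trans.
have pr0 (s : {ffun I -> bool}) : 0 <= \prod_i p i (s i) by apply: prodr_ge0.
rewrite [leLHS]big_mkcond [X in _ <= X + _]big_mkcond.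
rewrite [X in _ <= _ + X]big_mkcond -big_split /=.
apply: ler_sum => s _; rewrite mul1r mulN1r ler_normr.
by move: (#|I|%:R * t <= \sum_i _) (#|I|%:R * t <= - _) => [] [] /=;
  rewrite ?addr0 ?add0r ?lerDl ?addr_ge0.
Qed.

End Hoeffding.

(** * Concentration of independent signs *)

Section Concentration.
Variables (R : realType) (d : measure_display) (T : measurableType d).
Variable P : probability T R.

Lemma measure_bigsetU_le (I : finType) (Q : pred I) (A : I -> set T) :
  (forall i, measurable (A i)) ->
  (P (\big[setU/set0]_(i | Q i) A i) <= \sum_(i | Q i) P (A i))%E.
Proof.
move=> mA; suff [] : measurable (\big[setU/set0]_(i | Q i) A i) /\
  (P (\big[setU/set0]_(i | Q i) A i) <= \sum_(i | Q i) P (A i))%E by [].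
elim/big_rec2: _ => [|i x S _ [mS le]]; first by rewrite measure0.
split; first exact: measurableU.
by apply: le_trans (measureU2 _ _ _) _ => //; rewrite leeD2l.
Qed.

Lemma measurable_level (X : {RV P >-> R}) (x : R) :
  measurable (X @^-1` [set x]).
Proof. by rewrite -[_ @^-1` _]setTI; apply: measurable_funPT. Qed.

(** A sign variable is the difference of the indicators of its two level sets. *)
Lemma pm1_level_probabilities (X : {RV P >-> R}) (mu : R) :
  (forall w, X w = 1 \/ X w = -1) -> ('E_P[X] = mu%:E)%E ->
  let p b := fine (P (X @^-1` [set pm1 R b])) in
  p true + p false = 1 /\ p true - p false = mu.
Proof.
move=> X1 EX p.
have mT := measurable_level X 1.
have N11 : (-1 : R) <> 1.
  by apply/eqP; rewrite lt_eqF// (lt_trans (ltrN10 R)).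
have XN : X @^-1` [set -1] = ~` (X @^-1` [set 1]).
  apply/seteqP; split=> w /=; first by move=> ->.
  by case: (X1 w).
have pE b : P (X @^-1` [set pm1 R b]) = (p b)%:E.
  by rewrite fineK// fin_num_measure//; apply: measurable_level.
have sum1 : p true + p false = 1.
  apply: EFin_inj; rewrite EFinD -!pE /pm1 XN probability_setC//.
  by rewrite addeC subeK// fin_num_measure.
split=> //; apply: EFin_inj; rewrite -EX expectation_def.
rewrite (_ : (fun w => (X w)%:E) = fun w =>
  (\1_(X @^-1` [set 1]) w : R)%:E - (\1_(X @^-1` [set -1]) w : R)%:E)%E; last first.
  apply/funext => w; rewrite -EFinB; congr EFin; rewrite !indicE.
  case: (X1 w) => Xw; rewrite Xw.
    by rewrite mem_set// memNset ?subr0//= Xw => /esym.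
  by rewrite memNset ?sub0r ?mem_set//= Xw.
rewrite integralB_EFin//; try exact: integrable_indic (measurable_level _ _).
rewrite !integral_indic//; try exact: measurable_level.
by rewrite !setIT EFinB -!pE.
Qed.

(* The exceptional set is a finite union of events fixing all the signs, so that
   independence is only used on singletons and no integral is computed. *)
Lemma pm1_concentration (I : finType) (Y : I -> {RV P >-> R}) (mu t : R) :
  (forall i w, Y i w = 1 \/ Y i w = -1) ->
  (forall i, 'E_P[Y i] = mu%:E)%E ->
  (forall A : I -> set R, (forall i, measurable (A i)) ->
    P (\bigcap_i (Y i @^-1` A i)) = (\prod_i P (Y i @^-1` A i))%E) ->
  0 <= t ->
  exists B, [/\ measurable B,
    (P B <= (2 * expR (- (#|I|%:R * t ^+ 2 / 2)))%:E)%E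
    & forall w, ~ B w -> `|\sum_i (Y i w - mu)| < #|I|%:R * t].
Proof.
move=> Y1 EY indep t0.
pose p i b := fine (P (Y i @^-1` [set pm1 R b])).
have pE i b : P (Y i @^-1` [set pm1 R b]) = (p i b)%:E.
  by rewrite fineK// fin_num_measure//; apply: measurable_level.
pose G (s : {ffun I -> bool}) := \bigcap_i (Y i @^-1` [set pm1 R (s i)]).
have mG s : measurable (G s).
  by apply: fin_bigcap_measurable => // i _; apply: measurable_level.
have PG s : P (G s) = (\prod_i p i (s i))%:E.
  rewrite (indep (fun i => [set pm1 R (s i)])) => [|i]; last exact: measurable_set1.
  by rewrite -prodEFin; apply: eq_bigr => i _; exact: pE.
pose Q (s : {ffun I -> bool}) := #|I|%:R * t <= `|\sum_i (pm1 R (s i) - mu)|.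
exists (\big[setU/set0]_(s | Q s) G s); split.
- exact: bigsetU_measurable.
- apply: le_trans (measure_bigsetU_le _ mG) _.
  under eq_bigr do rewrite PG.
  rewrite sumEFin lee_fin; apply: hoeffding_two_sided => // [i b|i|i].
  + by rewrite fine_ge0.
  + by have [] := pm1_level_probabilities (Y1 i) (EY i).
  + by have [] := pm1_level_probabilities (Y1 i) (EY i).
- move=> w Bw; rewrite ltNge; apply/negP => Qw; apply: Bw.
  (* The sign vector read off from [w] places it in [G s]; a large deviation would make [s] satisfy
     [Q]. *)
  pose s := [ffun i => Y i w == 1].
  have sE i : Y i w = pm1 R (s i).
    rewrite /pm1 ffunE; case: eqP => [//|n]; by case: (Y1 i w).
  have Qs : Q s by rewrite /Q; under eq_bigr do rewrite -sE.
  by rewrite (bigD1 s)//=; left => i _; exact: sE.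
Qed.

(** The shots of one circuit are selected by the subset of indices whose first component is [k]. *)
Lemma mutually_independent_slice (K I : finType)
    (X : K * I -> {RV P >-> R}) (k : K) :
  mutually_independent X -> forall A : I -> set R, (forall i, measurable (A i)) ->
  P (\bigcap_i (X (k, i) @^-1` A i)) = (\prod_i P (X (k, i) @^-1` A i))%E.
Proof.
move=> indep A mA.
rewrite (_ : \bigcap_i _ =
    \bigcap_(r in [set` [set r : K * I | r.1 == k]%SET]) (X r @^-1` A r.2)); last first.
  apply/seteqP; split=> w h.
    by move=> [k' i]; rewrite /= inE /= => /eqP ->; exact: h.
  by move=> i _; have := h (k, i); rewrite /= inE /= eqxx; exact.
rewrite (indep _ (fun r => A r.2))// (reindex_onto (pair k) snd) /=; last first.
  by move=> [k' i]; rewrite inE /= => /eqP ->.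
by apply: eq_bigl => i; rewrite inE /= !eqxx.
Qed.

End Concentration.

(** * Thresholds, numbers of levels and of shots *)

Section Thresholds.
Variable R : realType.
Implicit Types delta xi eta eps x : R.

Lemma absz_ceil_bounds x : 0 <= x ->
  x <= (`|Num.ceil x|%N)%:R < x + 1.
Proof.
move=> x0; have c0 : 0 <= Num.ceil x by rewrite ceil_ge0 (lt_le_trans _ x0)// ltrN10.
have -> : (`|Num.ceil x|%N)%:R = (Num.ceil x)%:~R :> R.
  by rewrite -{2}(gez0_abs c0) pmulrn.
by rewrite ceil_ge /= -ltrBlDr -[1](mulr1z 1) -intrB ceilB1_lt.
Qed.

(** The bound [1 / 2] puts [(1 - delta)^-1 * delta] below 1, inside the domain where [sin] inverts
    [asin]. *)
Lemma delta_lt_half delta : delta < 2 * Num.sqrt 3 - 3 -> delta < 1 / 2.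
Proof.
move=> h; suff : Num.sqrt 3 <= 7 / 4 :> R by lra.
have s0 := sqrtr_ge0 (3 : R).
by have : Num.sqrt 3 ^+ 2 = 3 :> R; [rewrite sqr_sqrtr|nra].
Qed.

(** As [sin] increases on [[-pi/2, pi/2]], the lower bound on [xi] becomes
    [sin (pi * xi / 3) > delta / (1 - delta)], which is positivity of [beta]. *)
Lemma angle_threshold delta xi :
  0 < delta -> delta < 1 / 2 -> xi < 1 ->
  3 / pi * asin ((1 - delta)^-1 * delta) < xi ->
  [/\ 0 < pi * xi / 3, pi * xi / 3 < pi / 3 & 0 < beta delta xi].
Proof.
move=> d0 d1 xi1 hxi.
have pi0 := pi_gt0 R.
set x := _^-1 * delta in hxi.
have xE : (1 - delta) * x = delta by rewrite /x mulVKf// gt_eqF; lra.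
have x0 : 0 < x by rewrite mulr_gt0// invr_gt0; lra.
have x1 : x < 1 by rewrite /x mulrC ltr_pdivrMr; lra.
have xin : x \in `[(-1), 1] by rewrite in_itv /=; apply/andP; lra.
have xin' : -1 <= x <= 1 by apply/andP; lra.
have a1 := asin_geNpi2 xin'; have a2 := asin_lepi2 xin'.
have sa : sin (asin x) = x := asinK xin.
have a0 : 0 < asin x.
  rewrite -ltr_sin ?sin0 ?sa// in_itv /=; apply/andP; lra.
have axi : asin x < pi * xi / 3.
  by move: hxi; rewrite mulrAC ltr_pdivrMr// => ?; lra.
have ub : pi * xi / 3 < pi / 3.
  by rewrite ltr_pM2r ?invr_gt0// -[ltRHS]mulr1 ltr_pM2l.
split=> //; first exact: lt_trans axi.
have : sin (asin x) < sin (pi * xi / 3).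
  by rewrite ltr_sin// in_itv /=; apply/andP; lra.
rewrite sa /beta => h.
by rewrite subr_gt0 -[ltLHS]xE ltr_pM2l//; lra.
Qed.

Lemma beta_le1 delta xi : 0 < delta -> delta < 1 / 2 -> beta delta xi <= 1.
Proof. by move=> d0 d1; rewrite /beta; have := sin_le1 (pi * xi / 3); nra. Qed.

Lemma ln2_ge_half : 1 / 2 <= ln 2 :> R.
Proof.
have : ln (1 + (- (1 / 2))) <= - (1 / 2) :> R by apply: le_ln1Dx; lra.
rewrite (_ : 1 + - (1 / 2) = 2^-1); last by field.
by rewrite lnV ?posrE// lerN2.
Qed.

(** Rounding the logarithm up costs less than a factor 2. The lower bound serves the accuracy, the
    upper bound the cost. *)
Lemma num_levels_bounds xi eps : 0 < eps -> eps <= xi ->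
  xi / eps <= 2 ^+ num_levels xi eps < 2 * (xi / eps).
Proof.
move=> e0 exi.
have r1 : 1 <= xi / eps by rewrite ler_pdivlMr// mul1r.
have r0 : 0 < xi / eps by apply: lt_le_trans r1.
have l2 : 0 < ln 2 :> R by rewrite ln_gt0// ltr1n.
have /absz_ceil_bounds : 0 <= log2 (xi / eps) by rewrite /log2 divr_ge0 ?ln_ge0 ?ler1n.
rewrite -/(num_levels xi eps); set J := num_levels _ _.
have -> : 2 ^+ J = expR (J%:R * ln 2) :> R by rewrite expRM_natl lnK ?posrE.
move=> /andP[h1 h2]; rewrite /log2 ler_pdivrMr// in h1.
rewrite -ltrBlDr /log2 ltr_pdivlMr// mulrBl mul1r in h2.
apply/andP; split.
  by rewrite -[leLHS]lnK ?posrE// ler_expR.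
have r2 : 0 < 2 * (xi / eps) by rewrite mulr_gt0.
by rewrite -[ltRHS]lnK ?posrE// ltr_expR lnM ?posrE//; lra.
Qed.

End Thresholds.

Section Shots.
Variable R : realType.
Implicit Types delta xi eta eps b : R.

Lemma modulus_lt (z : R[i]) b : 0 < b ->
  `|complex.Re z| < b / Num.sqrt 2 -> `|complex.Im z| < b / Num.sqrt 2 ->
  modulus z < b.
Proof.
move=> b0 h1 h2.
have s0 : 0 < Num.sqrt 2 :> R by rewrite sqrtr_gt0.
have t0 : 0 <= b / Num.sqrt 2 by rewrite divr_ge0// ltW.
have tE : (b / Num.sqrt 2) ^+ 2 = b ^+ 2 / 2.
  by rewrite expr_div_n sqr_sqrtr.
rewrite -(@ltr_pXn2r _ 2)// ?nnegrE ?modulus_ge0// ?ltW// sqr_modulus.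
move: h1 h2; rewrite -![`|_| < _](@ltr_pXn2r _ 2)// ?nnegrE//.
rewrite !real_normK ?num_real// tE.
lra.
Qed.

Lemma ln_levels_ge1 eta (J : nat) : 0 < eta < 1 ->
  1 <= ln (4 / eta) + ln (J%:R + 1).
Proof.
move=> /andP[e0 e1]; have l2 := ln2_ge_half R.
have -> : ln (4 / eta) = 2 * ln 2 - ln eta.
  rewrite ln_div ?posrE// (_ : 4 = 2 ^+ 2); last by ring.
  by rewrite lnXn// mulr2n; ring.
have h1 : ln eta <= 0 by rewrite ln_le0// ltW.
have h2 : 0 <= ln (J%:R + 1) :> R by rewrite ln_ge0// lerDr.
lra.
Qed.

(** The ceiling adds less than 1, which [L / beta ^ 2 >= 1] absorbs by passing from 4 to 5. *)
Lemma num_shots_half_bounds delta xi eta eps :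
  0 < beta delta xi -> beta delta xi <= 1 -> 0 < eta < 1 ->
  let L := ln (4 / eta) + ln ((num_levels xi eps)%:R + 1) in
  4 * L / beta delta xi ^+ 2 <= ((num_shots delta xi eta eps)./2)%:R
    <= 5 * L / beta delta xi ^+ 2.
Proof.
move=> b0 b1 eta01 /=; set L := (ln _ + _).
have L1 : 1 <= L := ln_levels_ge1 _ eta01.
have bV : 1 <= (beta delta xi ^+ 2)^-1.
  by rewrite invf_ge1 ?exprn_gt0// exprn_ile1// ltW.
rewrite /num_shots mul2n doubleK.
have /absz_ceil_bounds : 0 <= 4 / beta delta xi ^+ 2 * L.
  by rewrite !mulr_ge0//; lra.
rewrite -/L; set n := (_%:R); set B := (_ ^+ 2)^-1 in bV *.
move=> /andP[h1 h2]; apply/andP; split; nra.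
Qed.

(** With tolerance [b / sqrt 2] the Hoeffding exponent is [n b^2 / 4], which exceeds [L] strictly
    because [b > beta]; and [expR (- L)] is [eta / (4 (J + 1))]. *)
Lemma union_bound_lt (J n : nat) eta beta b :
  0 < eta < 1 -> 0 < beta -> beta < b ->
  4 * (ln (4 / eta) + ln (J%:R + 1)) / beta ^+ 2 <= n%:R ->
  J.+1%:R * 2 * (2 * expR (- (n%:R * (b / Num.sqrt 2) ^+ 2 / 2))) < eta.
Proof.
move=> eta01 b0 bb; set L := (_ + _) => hn.
have L1 : 1 <= L := ln_levels_ge1 _ eta01.
move: eta01 => /andP[e0 e1].
have J0 : 0 < J%:R + 1 :> R by rewrite ltr_wpDl.
rewrite expr_div_n sqr_sqrtr//.
have B0 : 0 < beta ^+ 2 by rewrite exprn_gt0.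
rewrite ler_pdivrMr// in hn.
have n0 : 0 < n%:R :> R by nra.
have BB : beta ^+ 2 < b ^+ 2 by rewrite ltr_pXn2r// nnegrE ltW// (lt_trans b0).
have lt : L < n%:R * (b ^+ 2 / 2) / 2 by nra.
have : expR (- (n%:R * (b ^+ 2 / 2) / 2)) < expR (- L) by rewrite ltr_expR ltrN2.
rewrite [expR (- L)]expRN /L expRD !lnK ?posrE ?divr_gt0// => lt'.
rewrite -[J.+1%:R]natr1.
rewrite (_ : eta = (J%:R + 1) * 2 * (2 * (4 / eta * (J%:R + 1))^-1)); last first.
  by field; rewrite !gt_eqF.
by rewrite !ltr_pM2l ?mulr_gt0.
Qed.

(** * Circuit depths and cost bounds *)

Lemma T_max_le (J Ns : nat) : (T_max J Ns <= 2 ^ J)%N.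
Proof. by apply/bigmax_leqP => r _; rewrite leq_pexp2l// -ltnS. Qed.

(** One factor 2 counts the real and imaginary circuits, the other comes from the geometric sum of
    depths. *)
Lemma T_total_le (J Ns : nat) : (T_total J Ns <= 4 * 2 ^ J * Ns./2)%N.
Proof.
rewrite /T_total -(pair_bigA _ (fun jb i => depth (jb, i))) /=.
rewrite -(pair_bigA _ (fun j s => \sum_i depth (j, s, i)))%N /=.
under eq_bigr do rewrite big_bool /= /depth /= !sum_nat_const card_ord addnn -mul2n.
rewrite -big_distrr /= -big_distrr /= mulnCA.
have -> : (4 * 2 ^ J = 2 * 2 ^ J.+1)%N by rewrite expnS mulnA.
rewrite [leqRHS]mulnC; do 2 (apply: leq_mul => //).
elim: J => [|J IH]; first by rewrite big_ord_recr big_ord0.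
rewrite big_ord_recr /= [X in (_ <= X)%N]expnS mul2n -addnn leq_add//.
Qed.

(** With [E = ln eps^-1 > 4], one gets [J + 1 <= 2 + 2 E <= 4 E]. Both [ln 4] terms are then at most
    [ln E], giving three copies of [ln E] in all. *)
Lemma levels_log_le xi eta eps : 0 < eta < 1 -> 0 < eps -> eps <= xi -> xi < 1 ->
  eps < expR (-4) ->
  ln (4 / eta) + ln ((num_levels xi eps)%:R + 1) <=
    3 * (ln eta^-1 + ln (ln eps^-1)).
Proof.
move=> /andP[eta0 eta1] e0 exi xi1 e4.
set J := num_levels _ _.
have xi0 : 0 < xi by apply: lt_le_trans exi.
have l2 := ln2_ge_half R.
have r0 : 0 < xi / eps by rewrite divr_gt0.
have lE : 4 < ln eps^-1.
  rewrite lnV ?posrE// ltrNr -(expRK (-4)) ltr_ln ?posrE ?expR_gt0//.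
set E := ln eps^-1 in lE *.
have h1 : J%:R * ln 2 <= ln 2 + E.
  have /andP[_ h] := num_levels_bounds e0 exi; rewrite -/J in h.
  rewrite -(ler_expR) expRM_natl lnK ?posrE// expRD !lnK ?posrE ?invr_gt0//.
  apply/ltW/(lt_le_trans h); rewrite ler_pM2l//.
  by rewrite ler_piMl ?invr_ge0 ?ltW.
have h2 : J%:R + 1 <= 4 * E.
  have J0 : 0 <= J%:R :> R by [].
  have [//|] := lerP (J%:R + 1) (4 * E); nra.
have J1 : 0 < J%:R + 1 :> R by rewrite ltr_wpDl.
have h3 : ln (J%:R + 1) <= ln 4 + ln E.
  by rewrite -lnM ?posrE ?ler_ln ?posrE//; lra.
have h4 : ln 4 <= ln E by rewrite ler_ln ?posrE//; lra.
have h5 : 0 <= ln eta^-1 by rewrite ln_ge0// invf_ge1// ltW.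
by rewrite lnM ?posrE ?invr_gt0//; lra.
Qed.

End Shots.

(** * Success probability *)

(** The event is the preimage of an open set, the union of the balls of radius [c] about
    [a + 2 pi k]. *)
Lemma measurable_dist2pi_lt (R : realType) (d : measure_display)
    (T : measurableType d) (P : probability T R) (X : {RV P >-> R}) (a c : R) :
  measurable [set w | dist2pi (X w - a) < c].
Proof.
rewrite (_ : [set w | _] =
    X @^-1` (\bigcup_(k in [set: int]) ball (a + 2 * pi * k%:~R) c)).
  rewrite -[_ @^-1` _]setTI; apply: measurable_funPT => //.
  apply: open_measurable; apply: bigcup_open => k _; exact: ball_open.
apply/seteqP; split=> w /=.
  move=> /dist2pi_ltP[k h]; exists k => //.
  by rewrite -ball_normE /= distrC opprD addrA.
move=> [k _]; rewrite -ball_normE /= distrC opprD addrA => h.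
by apply/dist2pi_ltP; exists k.
Qed.

Lemma empirical_average_near (R : realType) (d : measure_display)
    (T : measurableType d) (J Ns : nat)
    (X : run J Ns -> T -> R) (j : 'I_J.+1) (w : T) (z : R[i]) (b : R) :
  0 < b ->
  `|\sum_(i < Ns./2) (X (j, true, i) w - complex.Re z)|
    < (Ns./2)%:R * (b / Num.sqrt 2) ->
  `|\sum_(i < Ns./2) (X (j, false, i) w - complex.Im z)|
    < (Ns./2)%:R * (b / Num.sqrt 2) ->
  modulus (empirical_average X j w - z) < b.
Proof.
move=> b0; set n := Ns./2 => hRe.
(* With no shots the strict bound [hRe] would have 0 on its right, so [n] is positive. *)
have nR : 0 < n%:R :> R.
  rewrite lt0r ler0n andbT; apply: contraTneq hRe => ->.
  by rewrite mul0r -leNgt.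
have avg (F : 'I_n -> R) mu : `|\sum_(i < n) (F i - mu)| < n%:R * (b / Num.sqrt 2) ->
    `|(\sum_(i < n) F i) / n%:R - mu| < b / Num.sqrt 2.
  rewrite sumrB sumr_const card_ord -[mu *+ _]mulr_natl => h.
  rewrite -(ltr_pM2l nR) -{1}(gtr0_norm nR) -normrM mulrBr.
  by rewrite [n%:R * (_ / n%:R)]mulrC divfK// gt_eqF.
move: hRe => /avg hRe /avg hIm.
by case: z hRe hIm => x y hRe hIm; apply: modulus_lt.
Qed.

Section Success.
Variables (R : realType) (d : measure_display) (T : measurableType d).
Variable P : probability T R.
Variables (m : nat) (U : 'M[R[i]]_m.+1) (psi : 'cV[R[i]]_m.+1).
Variables (J Ns : nat) (X : run J Ns -> {RV P >-> R}).
Hypothesis XP : hadamard_outcomes U psi X.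

(** Each pair of a level and a real or imaginary part has its own exceptional set, with tolerance
    [b / sqrt 2] so that the two parts combine to modulus below [b]. *)
Lemma all_averages_near (b : R) : 0 < b ->
  exists B, [/\ measurable B,
    (P B <= (J.+1%:R * 2 *
      (2 * expR (- ((Ns./2)%:R * (b / Num.sqrt 2) ^+ 2 / 2))))%:E)%E
    & forall w, ~ B w -> forall j : 'I_J.+1,
      modulus (empirical_average X j w - braket psi (U ^+ (2 ^ j) *m psi)) < b].
Proof.
move=> b0; have [X1 XRe XIm Xind] := XP.
set t := b / Num.sqrt 2; set q := 2 * _.
have t0 : 0 <= t by rewrite divr_ge0 ?sqrtr_ge0// ltW.
pose mu (k : 'I_J.+1 * bool) : R :=
  let z := braket psi (U ^+ (2 ^ k.1) *m psi) in
  if k.2 then complex.Re z else complex.Im z.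
have /choice[B BP] (k : 'I_J.+1 * bool) : exists B, [/\ measurable B,
    (P B <= q%:E)%E
    & forall w, ~ B w -> `|\sum_i (X (k, i) w - mu k)| < (Ns./2)%:R * t].
  have [||A mA|B [h1 h2 h3]] :=
    @pm1_concentration _ _ _ P _ (fun i => X (k, i)) (mu k) t _ _ _ t0.
  - by move=> i w; apply: X1.
  - by case: k => j [] i; [exact: XRe|exact: XIm].
  - exact: mutually_independent_slice.
  - by exists B; split=> //; move: h2 h3; rewrite card_ord.
exists (\big[setU/set0]_k B k); split.
- by apply: bigsetU_measurable => k _; have [] := BP k.
- apply: le_trans (measure_bigsetU_le _ _ _) _ => [k|]; first by have [] := BP k.
  apply: (@le_trans _ _ (\sum_(k : 'I_J.+1 * bool) q%:E)%E).
    by apply: lee_sum => k _; have [] := BP k.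
  rewrite sumEFin sumr_const card_prod card_ord card_bool lee_fin.
  by rewrite -[q *+ _]mulr_natl natrM.
- move=> w Bw j.
  have Bk k : ~ B k w by move=> h; apply: Bw; rewrite (bigD1 k)//=; left.
  apply: empirical_average_near => //.
  + by have [_ _] := BP (j, true); apply.
  + by have [_ _] := BP (j, false); apply.
Qed.

Variables (psis : 'I_m.+1 -> 'cV[R[i]]_m.+1) (lambda : 'I_m.+1 -> R).
Variables (a0 : R) (theta : nat -> {RV P >-> R}).
Hypothesis psisP : orthonormal_eigenvectors U psis lambda.
Hypothesis psi1 : braket psi psi = 1.
Hypothesis thetaP : algorithm_angles a0 X theta.
Let p0 := modulus (braket psi (psis ord0)) ^+ 2.

Lemma theta_near (w : T) (alpha : R) : 0 < p0 -> 0 < alpha -> alpha <= pi / 3 ->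
  (forall j : 'I_J.+1,
    modulus (empirical_average X j w - braket psi (U ^+ (2 ^ j) *m psi))
      < p0 * sin alpha - (1 - p0)) ->
  dist2pi (theta J w - lambda ord0) < alpha / 2 ^+ J.
Proof.
move=> p00 al0 al3 near; have pi0 := pi_gt0 R.
pose z j := empirical_average X (inord j) w.
apply: (@angles_near R a0 J z (fun j => theta j w)) => // j jJ.
- apply: parg_near p00 _ _; first by apply/andP; lra.
  rewrite /z; have := near (inord j); have := braket_expmx_near psisP psi1 (2 ^ j).
  rewrite inordK// natrX; set u := braket _ _; set v := _ * expi _ => h1 h2.
  (* The sampling error and the spectral error [1 - p0] add up to less than [p0 * sin alpha]. *)
  rewrite (_ : _ - v = (empirical_average X (inord j) w - u) + (u - v)); last first.
    by rewrite addrA subrK.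
  apply: le_lt_trans (le_normcD _ _) _.
  by rewrite -/(modulus _) -/(modulus (u - v)); move: h1 h2; rewrite -/p0; lra.
- have := thetaP w (inord j); rewrite /previous inordK//.
Qed.

End Success.

Lemma success_probability (R : realType) (m : nat) (U : 'M[R[i]]_m.+1)
    (psis : 'I_m.+1 -> 'cV[R[i]]_m.+1) (lambda : 'I_m.+1 -> R)
    (psi : 'cV[R[i]]_m.+1) (delta xi eta eps : R)
    (d : measure_display) (T : measurableType d) (P : probability T R)
    (J := num_levels xi eps) (Ns := num_shots delta xi eta eps)
    (X : run J Ns -> {RV P >-> R}) (a0 : R) (theta : nat -> {RV P >-> R}) :
  orthonormal_eigenvectors U psis lambda -> braket psi psi = 1 ->
  1 - delta < modulus (braket psi (psis ord0)) ^+ 2 -> delta < 1 / 2 ->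
  0 < pi * xi / 3 -> pi * xi / 3 < pi / 3 ->
  0 < beta delta xi -> beta delta xi <= 1 ->
  0 < eta < 1 -> 0 < eps -> eps <= xi ->
  hadamard_outcomes U psi X -> algorithm_angles a0 X theta ->
  (P [set w | (dist2pi (theta J w - lambda ord0) < pi / 3 * eps)%R]
     > (1 - eta)%:E)%E.
Proof.
move=> psisP psi1; set p0 := _ ^+ 2 => hp d1 al0 al1 b0 b1 eta01 e0 exi XP thetaP.
have pi0 := pi_gt0 R.
set alpha := pi * xi / 3 in al0 al1.
pose b := p0 * sin alpha - (1 - p0).
have s0 : 0 < sin alpha by apply: sin_gt0_pihalf; apply/andP; lra.
(* [b] is [p0 (1 + sin alpha) - 1], increasing in [p0] and equal to [beta] at [p0 = 1 - delta]. *)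
have bb : beta delta xi < b by rewrite /beta -/alpha /b; nra.
have [B [mB PB BP]] := all_averages_near XP (lt_trans b0 bb).
have /andP[hn _] := num_shots_half_bounds eps b0 b1 eta01.
have PBlt : (P B < eta%:E)%E.
  by apply: le_lt_trans PB _; rewrite lte_fin; apply: union_bound_lt b0 bb hn.
apply: (@lt_le_trans _ _ (P (~` B))).
  rewrite probability_setC// EFinB -(fineK (fin_num_measure P B mB)) lte_fin.
  by rewrite -(fineK (fin_num_measure P B mB)) lte_fin in PBlt; lra.
apply: le_measure; rewrite ?inE; [exact: measurableC|exact: measurable_dist2pi_lt|].
move=> w /BP near /=; apply: lt_le_trans.
  by apply: (theta_near psisP psi1 thetaP _ al0 (ltW al1) near); rewrite -/p0; lra.
have /andP[h _] := num_levels_bounds e0 exi.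
rewrite ler_pdivrMr ?exprn_gt0//; rewrite ler_pdivrMr// in h.
rewrite /alpha (_ : pi * xi / 3 = pi / 3 * xi); last by ring.
by rewrite -[leRHS]mulrA ler_pM2l ?divr_gt0// [eps * _]mulrC.
Qed.

(** [C] and [eps0] are chosen before all other data, which makes the implied constants uniform. *)
Theorem theorem5 (R : realType) :
  exists C eps0 : R, [/\ 0 < C, 0 < eps0 &
  forall (m : nat) (U : 'M[R[i]]_m.+1)
    (psis : 'I_m.+1 -> 'cV[R[i]]_m.+1) (lambda : 'I_m.+1 -> R)
    (psi : 'cV[R[i]]_m.+1) (delta xi eta eps : R)
    (J Ns : nat)
    (d : measure_display) (T : measurableType d) (P : probability T R)
    (X : run J Ns -> {RV P >-> R}) (a0 : R) (theta : nat -> {RV P >-> R}),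
  U \is unitarymx ->
  orthonormal_eigenvectors U psis lambda ->
  braket psi psi = 1 ->
  modulus (braket psi (psis ord0)) ^+ 2 > 1 - delta ->
  delta < 2 * Num.sqrt 3 - 3 ->
  1 > xi ->
  xi > 3 / pi * asin ((1 - delta)^-1 * delta) ->
  0 < eta < 1 ->
  0 < eps < 1 ->
  eps <= xi ->
  J = num_levels xi eps ->
  Ns = num_shots delta xi eta eps ->
  hadamard_outcomes U psi X ->
  algorithm_angles a0 X theta ->
  (P [set w | (dist2pi (theta J w - lambda ord0) < pi / 3 * eps)%R]
     > (1 - eta)%:E)%E
  /\
  (eps < eps0 ->
     (T_max J Ns)%:R <= C * (xi * eps^-1) /\
     (T_total J Ns)%:R <=
       C * (xi * eps^-1 / beta delta xi ^+ 2 *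
              (ln eta^-1 + ln (ln eps^-1))))].
Proof.
(* [120 = 4 * 2 * 5 * 3]: from [T_total_le], [num_levels_bounds], [num_shots_half_bounds] and
   [levels_log_le]; the last also fixes [expR (-4)]. *)
exists 120, (expR (-4)); split; [by []|exact: expR_gt0|].
move=> m U psis lambda psi delta xi eta eps J Ns d T P X a0 theta.
move=> _ psisP psi1 hp hdelta xi1 hxi eta01 /andP[e0 e1] exi JE NsE XP thetaP.
subst J Ns.
have d1 := delta_lt_half hdelta.
(* A modulus bounded by [1 - p0] shows [p0 <= 1], while [p0 > 1 - delta]. *)
have d0 : 0 < delta.
  have := braket_expmx_near psisP psi1 0.
  by move/(le_trans (modulus_ge0 _)); lra.
have [al0 al1 b0] := angle_threshold d0 d1 xi1 hxi.
have b1 := beta_le1 xi d0 d1.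
split.
  exact: success_probability psisP psi1 hp d1 al0 al1 b0 b1 eta01 e0 exi XP thetaP.
move=> e4.
have r0 : 0 < xi * eps^-1 by rewrite divr_gt0// (lt_le_trans e0).
have /andP[_ J2] := num_levels_bounds e0 exi.
split.
  apply: (@le_trans _ _ (2 ^+ num_levels xi eps)).
    by rewrite -natrX ler_nat T_max_le.
  by apply: le_trans (ltW J2) _; rewrite ler_pM2r// ler_nat.
have /andP[_ hn] := num_shots_half_bounds eps b0 b1 eta01.
have hL := levels_log_le eta01 e0 exi xi1 e4.
have B0 : 0 < (beta delta xi ^+ 2)^-1 by rewrite invr_gt0 exprn_gt0.
move: hn hL; set L := (ln (4 / eta) + _); set M := (ln eta^-1 + _).
set B := (_ ^+ 2)^-1 in B0 *; set Ns := num_shots _ _ _ _.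
set J := num_levels _ _ in J2 *.
move=> hn hL.
apply: (@le_trans _ _ (4 * 2 ^+ J * (Ns./2)%:R)).
  by rewrite -natrX -!natrM ler_nat T_total_le.
have hn' : (Ns./2)%:R <= 15 * M * B.
  by apply: le_trans hn _; rewrite ler_pM2r//; lra.
rewrite (_ : 120 * _ = 4 * (2 * (xi * eps^-1)) * (15 * M * B)); last by ring.
by apply: ler_pM => //; rewrite ler_pM2l// ltW.
Qed.
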